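(* Let $n, d\geq 1$ be integers and let $\mu_1,\ldots,\mu_n$ be Borel probability measures on $\mathbb{R}^d$. For a subset $S\subset[n]=\{1,\ldots,n\}$, let $\mu_S$ be the convolution of the measures $(\mu_i; i\in S)$. Then $$C_{LS}(\mu_{[n]}) \leq \sum_{S\subset[n]} r_S\, C_{LS}(\mu_S)$$ for any real non-negative coefficients $(r_S)_{S\subset[n]}$ satisfying $\sum_{S\ni i} r_S\geq 1$ for all $i\in[n]$ (the sum being over all subsets $S\subset[n]$ containing $i$).
   Context: A Borel probability measure $\mu$ on $\mathbb{R}^d$ satisfies the logarithmic Sobolev inequality with constant $C\ge 0$ when $$\operatorname{Ent}_\mu(f^2) := \int f^2\log f^2\,d\mu - \left(\int f^2\,d\mu\right) \log\left(\int f^2\,d\mu\right) \leq 2C\int |\nabla f|^2\,d\mu$$ for all smooth compactly supported test functions $f:\mathbb{R}^d\to\mathbb{R}$ (with $0\log 0=0$; $|\cdot|$ is the Euclidean norm). The smallest such constant $C$ is the log-Sobolev constant $C_{LS}(\mu)\in[0,\infty]$, with $C_{LS}(\mu)=\infty$ if no such inequality holds. Conventions: the sum over $S\subset[n]$ runs over all subsets of $[n]$, including $\emptyset$ and $[n]$; the empty convolution $\mu_\emptyset$ is the Dirac mass $\delta_0$ at the origin (so $C_{LS}(\mu_\emptyset)=0$); and $0\cdot\infty=0$. *)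

(* Defs.v *)
From HB Require Import structures.
From mathcomp Require Import all_boot all_order all_algebra.
From mathcomp Require Import all_classical all_reals all_analysis.
From mathcomp Require Import ring lra.
Set Implicit Arguments.
Unset Strict Implicit.
Unset Printing Implicit Defensive.

Import Order.TTheory GRing.Theory Num.Theory.
Import numFieldNormedType.Exports.

Local Open Scope classical_set_scope.
Local Open Scope ring_scope.

(* 'rV[R]_d carries the topology of the sup norm, i.e. the usual one, so this
   is R^d with its Borel sigma-algebra. *)
Definition borelRV (R : realType) (d : nat) :=
  g_sigma_algebraType (@open 'rV[R]_d).

Definition add_borelRV (R : realType) (d : nat)
    (p : borelRV R d * borelRV R d) : borelRV R d :=
  (p.1 : 'rV[R]_d) + (p.2 : 'rV[R]_d).

Section measurable_add.
Variables (R : realType) (d : nat).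

Lemma rat_ball_approx (x : 'rV[R]_d) (e : R) : 0 < e ->
  exists q : 'rV[rat]_d, ball (map_mx ratr q : 'rV[R]_d) e x.
Proof.
move=> e0.
have /choice[g gP] (i : 'I_d) : exists r : rat, `|ratr r - x 0 i| < e.
  have : x 0 i - e < x 0 i + e by lra.
  move=> /rat_in_itvoo[r]; rewrite in_itv/= => /andP[r1 r2].
  by exists r; rewrite ltr_distl r1.
exists (\row_i g i); split => // i j.
by rewrite !mxE ord1; exact: gP.
Qed.

Lemma measurable_add_borelRV : measurable_fun [set: _] (@add_borelRV R d).
Proof.
apply: (measurability (@open 'rV[R]_d : set (set (borelRV R d)))); first by [].
move=> _ [U oU <-]; rewrite setTI.
pose I := ('rV[rat]_d * 'rV[rat]_d * nat)%type.
pose B (q : 'rV[rat]_d) (k : nat) : set (borelRV R d) :=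
  ball (map_mx ratr q : 'rV[R]_d) (k.+1%:R^-1 : R).
have mB q k : measurable (B q k).
  by apply: sub_sigma_algebra; apply: ball_open; rewrite invr_gt0.
pose F (i : I) : set (borelRV R d * borelRV R d) :=
  B i.1.1 i.2 `*` B i.1.2 i.2.
have -> : @add_borelRV R d @^-1` U =
    \bigcup_(i in [set i : I | F i `<=` @add_borelRV R d @^-1` U]) F i.
  apply/seteqP; split => [[x y] /= Uxy|z [i iP Fi]]; last exact: iP.
  have /nbhs_ballP[e /= e0 eU] :
      nbhs ((x : 'rV[R]_d) + (y : 'rV[R]_d)) (U : set 'rV[R]_d).
    exact: open_nbhs_nbhs.
  have [k ke] : exists k : nat, (k.+1%:R^-1 : R) < e / 4.
    have e40 : 0 < e / 4 by rewrite divr_gt0.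
    have [N _ NP] := near_infty_natSinv_lt (PosNum e40).
    by exists N; exact: (NP N (leqnn N)).
  have k0 : 0 < (k.+1%:R^-1 : R) by rewrite invr_gt0.
  have [q qx] := rat_ball_approx x k0.
  have [q' qy] := rat_ball_approx y k0.
  exists (q, q', k); last by split.
  move=> [u v] /= [/= Bu Bv]; apply: eU.
  move: qx qy Bu Bv; rewrite /B -!ball_normE /= => qx qy Bu Bv.
  have -> : (x : 'rV[R]_d) + (y : 'rV[R]_d) - (add_borelRV (u, v) : 'rV[R]_d) =
      (- (map_mx ratr q - x) - (map_mx ratr q' - y))
      + ((map_mx ratr q - (u : 'rV[R]_d)) + (map_mx ratr q' - (v : 'rV[R]_d))).
    by rewrite /add_borelRV/=; apply/rowP => i; rewrite !mxE; ring.
  apply: (le_lt_trans (ler_normD _ _)).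
  apply: (le_lt_trans (lerD (ler_normD _ _) (ler_normD _ _))).
  rewrite !normrN.
  have lt4 (a b a' b' t : R) : a < t -> b < t -> a' < t -> b' < t ->
    t < e / 4 -> a + b + (a' + b') < e by lra.
  exact: (lt4 _ _ _ _ _ qx qy Bu Bv ke).
rewrite bigcup_mkcond; apply: countable_bigcupT_measurable; first exact: countableP.
by move=> i; case: ifP => // _; exact: measurableX.
Qed.

HB.instance Definition _ :=
  isMeasurableFun.Build _ _ _ _ (@add_borelRV R d) measurable_add_borelRV.

End measurable_add.

Section log_sobolev_constant.
Variables (R : realType) (d : nat).
Implicit Types (mu nu : probability (borelRV R d) R) (f : 'rV[R]_d -> R).

(* Law of X + Y for independent X ~ mu and Y ~ nu. *)
Definition convolution mu nu : probability (borelRV R d) R :=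
  distribution (mu \x nu)%E (@add_borelRV R d).

Definition dirac_origin : probability (borelRV R d) R :=
  \d_((0 : 'rV[R]_d) : borelRV R d).

(* Iterated partial derivative: [:: i; j] stands for d_i d_j f. *)
Definition partials (s : seq 'I_d) f : 'rV[R]_d -> R :=
  foldr (fun i g => 'D_(delta_mx 0 i) g) f s.

(* 'D_v is a total operator, hence the explicit derivability requirement. *)
Definition smooth f := forall s : seq 'I_d,
  continuous (partials s f) /\
  forall (i : 'I_d) (x : 'rV[R]_d), derivable (partials s f) x (delta_mx 0 i).

Definition compactly_supported f := compact (closure [set x | f x != 0]).

Definition gradient f (x : 'rV[R]_d) : 'rV[R]_d :=
  \row_i 'D_(delta_mx 0 i) f x.

(* The library norm `|v| on 'rV[R]_d is the sup norm. *)
Definition euclidean_norm (v : 'rV[R]_d) : R :=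
  Num.sqrt (\sum_i v 0 i ^+ 2).

(* ln vanishes at 0, so 0 * ln 0 = 0. The real-valued integrals are used only on
   bounded Borel functions, which are mu-integrable. *)
Definition entropy mu (g : 'rV[R]_d -> R) : R :=
  (\int[mu]_x (g x * ln (g x))) - (\int[mu]_x g x) * ln (\int[mu]_x g x).

Definition log_sobolev mu (C : R) :=
  forall f, smooth f -> compactly_supported f ->
  entropy mu (fun x => f x ^+ 2) <=
    2 * C * \int[mu]_x (euclidean_norm (gradient f x) ^+ 2).

(* +oo when no constant is admissible. *)
Definition log_sobolev_constant mu : \bar R :=
  ereal_inf [set C%:E | C in [set C : R | 0 <= C /\ log_sobolev mu C]].

End log_sobolev_constant.

(* A fold over the elements of S in increasing order; the order is irrelevant
   since convolution is commutative and associative. *)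
Definition convolution_family (R : realType) (d n : nat)
    (mu : 'I_n -> probability (borelRV R d) R) (S : {set 'I_n}) :
    probability (borelRV R d) R :=
  \big[@convolution R d/dirac_origin R d]_(i in S) mu i.

(* Main.v *)
Require Import Defs.
From mathcomp Require Import all_boot all_order all_algebra.
From mathcomp Require Import all_classical all_reals all_analysis.
From mathcomp Require Import measurable_realfun ring lra.

(** Shearer's inequality for entropy, transported to convolutions.  For a
    measure nu on R^d let T_nu g (s) be the nu-average of the translate
    g (s + .); then T_(mu * nu) = T_mu T_nu, and these operators commute.  With
    T_S the operator of mu_S, with phi t = t ln t and g = f ^ 2, put

      D S = T_[n] (phi g) (0) - T_(~S) (phi (T_S g)) (0).

    Since T_[n] = T_(~S) T_S, this is the mu_(~S)-average over y of the entropy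
    of f (y + .) ^ 2 under mu_S.  Translates of test functions are test
    functions, so the log-Sobolev inequality of mu_S gives
    D S <= 2 C_S \int |grad f| ^ 2 d mu_[n] (entropy_drop_log_sobolev), while
    D [n] is the entropy of f ^ 2 under mu_[n] (entropy_drop_full).  It remains
    to see that D [n] <= \sum_S r_S D S.

    D vanishes on the empty set, is monotone by Jensen's inequality for phi
    (entropy_drop_mono), and is submodular (entropy_drop_submod).
    Submodularity is a statement about a function w of two independent
    variables, obtained by averaging over the common indices of the two sets:
    the entropy of w is at least the sum of the entropies of its two marginals
    (xlnx_marginals).  For any nonnegative fractional cover r, such a set
    function satisfies the required inequality: D S is a sum of increments
    along the chain of initial segments of S, and by submodularity each
    increment dominates the corresponding one along the initial segments of
    [n] (shearer_submodular).

    The proofs of the two analytic inequalities take logarithms of averages of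
    g and divide by them, hence are carried out for g bounded below by a
    positive constant.  The general case follows by applying them to
    g + e ^ 2: on bounded intervals this changes phi by O(e), and therefore
    D S by O(e), uniformly in S. *)

Set Implicit Arguments.
Unset Strict Implicit.
Unset Printing Implicit Defensive.

Import Order.TTheory GRing.Theory Num.Theory.
Import numFieldNormedType.Exports.

Local Open Scope classical_set_scope.
Local Open Scope ring_scope.

(** * The function t ln t *)

Section xlnx.
Variable R : realType.
Implicit Types t m M e a b : R.

Definition xlnx t : R := t * ln t.

Lemma ln_leB1 t : 0 < t -> ln t <= t - 1.
Proof.
move=> t0; have := @le_ln1Dx _ (t - 1).
by rewrite [1 + _]addrC subrK; apply; lra.
Qed.

(** Convexity: this is the tangent line of [xlnx] at [m], rearranged to have no
    [ln t] outside [xlnx]. *)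
Lemma xlnx_tangent t m : 0 <= t -> 0 < m -> t - m <= xlnx t - t * ln m.
Proof.
rewrite /xlnx le_eqVlt => /predU1P[<- m0|t0 m0].
  by rewrite !mul0r; lra.
have := ln_leB1 (divr_gt0 m0 t0).
rewrite ln_div ?posrE// -(ler_pM2l t0) !mulrBr mulrCA divff ?gt_eqF//; lra.
Qed.

(** The tangent line at [u * v / m], the value that the joint density [t]
    would have if the two variables with marginals [u] and [v] were
    independent. *)
Lemma xlnx_tangent_ratio t u v m : 0 < t -> 0 < u -> 0 < v -> 0 < m ->
  t - u * v * m^-1 <= xlnx t - (t * ln u + t * ln v - t * ln m).
Proof.
move=> t0 u0 v0 m0.
have := xlnx_tangent (ltW t0) (divr_gt0 (mulr_gt0 u0 v0) m0).
by rewrite ln_div ?posrE ?mulr_gt0// lnM ?posrE// mulrBr mulrDr.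
Qed.

Lemma xlnx_ge t : 0 <= t -> - 1 <= xlnx t.
Proof.
by move=> t0; have := xlnx_tangent t0 ltr01; rewrite ln1 mulr0; lra.
Qed.

Lemma xlnx_le t b : 0 <= t <= b -> xlnx t <= b ^+ 2.
Proof.
move=> /andP[]; rewrite /xlnx le_eqVlt => /predU1P[<-|t0] tb.
  by rewrite mul0r sqr_ge0.
have b0 := lt_le_trans t0 tb.
rewrite (@le_trans _ _ (t * b)) ?ler_wpM2l ?(ltW t0)//.
  by have := ln_leB1 t0; lra.
by rewrite expr2 ler_wpM2r// ltW.
Qed.

(** A modulus of continuity that is uniform up to [t = 0], where [xlnx] has
    infinite slope: a perturbation of size [e ^+ 2] costs only [O(e)].  The
    lower bound comes from superadditivity of [xlnx], the upper bound from the
    tangent line at [t + e ^+ 2]. *)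
Lemma xlnx_perturb t M e : 0 <= t <= M -> 0 < e <= 1 ->
  `|xlnx (t + e ^+ 2) - xlnx t| <= (M + 2) * e.
Proof.
move=> /andP[t0 tM] /andP[e0 e1].
have e20 : 0 < e ^+ 2 by rewrite exprn_gt0.
have te0 : 0 < t + e ^+ 2 by lra.
have e2e : e ^+ 2 <= e by rewrite expr2 ler_piMl// ltW.
have Me2 : (M + 1) * e ^+ 2 <= (M + 1) * e by rewrite ler_wpM2l//; lra.
rewrite ler_norml; apply/andP; split.
  have lo : - 2 * e <= xlnx (e ^+ 2).
    have -> : xlnx (e ^+ 2) = 2 * e * xlnx e.
      by rewrite /xlnx lnXn// -mulr_natl; ring.
    (* since [xlnx (e ^+ 2) = 2 * e * xlnx e] and [xlnx >= -1] *)
    have : 0 <= e * (xlnx e + 1).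
      by rewrite mulr_ge0 ?(ltW e0)//; have := xlnx_ge (ltW e0); lra.
    lra.
  have up : xlnx t + xlnx (e ^+ 2) <= xlnx (t + e ^+ 2).
    rewrite /xlnx mulrDl lerD//.
      move: t0; rewrite le_eqVlt => /predU1P[<-|t0]; first by rewrite !mul0r.
      by rewrite ler_wpM2l ?(ltW t0)// ler_ln ?posrE//; lra.
    by rewrite ler_wpM2l ?(ltW e20)// ler_ln ?posrE//; lra.
  have : 0 <= M * e by rewrite mulr_ge0//; lra.
  lra.
have h1 := xlnx_tangent t0 te0.
have h2 : e ^+ 2 * ln (t + e ^+ 2) <= e ^+ 2 * M.
  by rewrite ler_wpM2l ?(ltW e20)//; have := ln_leB1 te0; lra.
rewrite [xlnx (_ + _)]/xlnx mulrDl; lra.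
Qed.

Lemma measurable_xlnx : measurable_fun setT xlnx.
Proof. by apply: measurable_funM => //; exact: measurable_ln. Qed.

Lemma normr_le_within t a b : a <= t <= b -> `|t| <= `|a| + `|b|.
Proof.
move=> /andP[at_ tb]; rewrite ler_norml.
have ha := ler_norm (- a); have hb := ler_norm b; rewrite normrN in ha.
have ha0 := normr_ge0 a; have hb0 := normr_ge0 b.
by apply/andP; split; lra.
Qed.

End xlnx.
Arguments xlnx {R} t.

(** * Bounded measurable functions *)

Section measurable_within.
Variables (R : realType).

(** Averages against a probability measure preserve such pointwise bounds, which
    keeps every function below integrable; a positive [a] moreover keeps
    logarithms bounded. *)
Definition measurable_within d (T : measurableType d) (a b : R) (f : T -> R) :=
  measurable_fun setT f /\ forall x, a <= f x <= b.

Lemma measurable_within_xlnx d (T : measurableType d) (a b : R)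
    (f : T -> R) :
  0 <= a -> measurable_within a b f ->
  measurable_within (- 1) (b ^+ 2) (xlnx \o f).
Proof.
move=> a0 [mf fab]; split.
  exact: measurableT_comp (@measurable_xlnx R) mf.
move=> x; have /andP[af fb] := fab x.
have f0 := le_trans a0 af.
by rewrite /= xlnx_ge// xlnx_le// f0.
Qed.

Section one_measure.
Context d (T : measurableType d) (P : probability T R).
Implicit Types (a b : R) (f g : T -> R).

Lemma measurable_within_integrable a b f :
  measurable_within a b f -> P.-integrable setT (EFin \o f).
Proof.
move=> [mf fab]; apply: measurable_bounded_integrable => //.
  by apply: le_lt_trans (probability_le1 P _) (ltry 1).
exists (`|a| + `|b|); split; first exact: num_real.
by move=> M abM x _ /=; exact: le_trans (normr_le_within (fab x)) (ltW abM).
Qed.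

Lemma Rintegral_prob_cst (r : R) : \int[P]_x r = r.
Proof.
by rewrite Rintegral_cst// [X in fine X](probability_setT P) mulr1.
Qed.

Lemma Rintegral_within a b f : measurable_within a b f ->
  a <= \int[P]_x f x <= b.
Proof.
move=> fab; have fi := measurable_within_integrable fab.
have ci (r : R) : P.-integrable setT (EFin \o cst r).
  by apply: (@measurable_within_integrable r r); split=> // x; rewrite lexx.
case: fab => _ fab.
rewrite -[a]Rintegral_prob_cst -[b]Rintegral_prob_cst.
by apply/andP; split; apply: le_Rintegral => //; try exact: ci;
  move=> x _; have /andP[] := fab x.
Qed.

End one_measure.

Section two_measures.
Context d1 d2 (X : measurableType d1) (Y : measurableType d2).
Variables (P : probability X R) (Q : probability Y R).
Variables (a b : R) (w : X * Y -> R).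
Hypothesis wab : measurable_within a b w.

Lemma measurable_within_pair1 x : measurable_within a b (fun y => w (x, y)).
Proof.
case: wab => mw ww; split=> //.
exact: measurableT_comp mw (pair1_measurable x).
Qed.

Lemma measurable_within_pair2 y : measurable_within a b (fun x => w (x, y)).
Proof.
case: wab => mw ww; split=> //.
exact: measurableT_comp mw (pair2_measurable y).
Qed.

Let iw : (P \x Q)%E.-integrable setT (EFin \o w).
Proof. exact: (measurable_within_integrable (P \x Q)%E wab). Qed.

Lemma measurable_within_marginal1 :
  measurable_within a b (fun x => \int[Q]_y w (x, y)).
Proof.
split=> [|x]; last exact/Rintegral_within/measurable_within_pair1.
apply: measurableT_comp => //.
exact: (@measurable_fubini_F _ _ _ _ _ P Q _ iw).
Qed.

Lemma measurable_within_marginal2 :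
  measurable_within a b (fun y => \int[P]_x w (x, y)).
Proof.
split=> [|y]; last exact/Rintegral_within/measurable_within_pair2.
apply: measurableT_comp => //.
exact: (@measurable_fubini_G _ _ _ _ _ P Q _ iw).
Qed.

Lemma Rintegral_prod1 :
  \int[(P \x Q)%E]_z w z = \int[P]_x \int[Q]_y w (x, y).
Proof.
rewrite /Rintegral -(integral12_prod_meas1 iw); congr fine.
apply: eq_integral => x _; rewrite fineK//.
exact/integrable_fin_num/measurable_within_integrable/measurable_within_pair1.
Qed.

Lemma Rintegral_prod2 :
  \int[(P \x Q)%E]_z w z = \int[Q]_y \int[P]_x w (x, y).
Proof.
rewrite /Rintegral -(integral21_prod_meas1 iw); congr fine.
apply: eq_integral => y _; rewrite fineK//.
exact/integrable_fin_num/measurable_within_integrable/measurable_within_pair2.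
Qed.

Lemma Rintegral_swap :
  \int[P]_x \int[Q]_y w (x, y) = \int[Q]_y \int[P]_x w (x, y).
Proof. by rewrite -Rintegral_prod1 Rintegral_prod2. Qed.

End two_measures.
End measurable_within.

Section bounded_measurable.
Context (R : realType) d (T : measurableType d).
Implicit Types (f g : T -> R).

Definition bounded_measurable f := exists a b : R, measurable_within a b f.

Lemma bounded_measurableP f : bounded_measurable f <->
  measurable_fun setT f /\ exists M, forall x, `|f x| <= M.
Proof.
split=> [[a [b [mf fab]]]|[mf [M fM]]]; last first.
  by exists (- M), M; split=> // x; rewrite -ler_norml.
by split=> //; exists (`|a| + `|b|) => x; exact: normr_le_within.
Qed.

Lemma bounded_measurable_cst (c : R) : bounded_measurable (fun=> c).
Proof. by exists c, c; split=> // x; rewrite lexx. Qed.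

Lemma bounded_measurableD f g : bounded_measurable f -> bounded_measurable g ->
  bounded_measurable (fun x => f x + g x).
Proof.
move=> /bounded_measurableP[mf [M fM]] /bounded_measurableP[mg [N gN]].
apply/bounded_measurableP; split; first exact: measurable_funD.
by exists (M + N) => x; rewrite (le_trans (ler_normD _ _))// lerD.
Qed.

Lemma bounded_measurableM f g : bounded_measurable f -> bounded_measurable g ->
  bounded_measurable (fun x => f x * g x).
Proof.
move=> /bounded_measurableP[mf [M fM]] /bounded_measurableP[mg [N gN]].
apply/bounded_measurableP; split; first exact: measurable_funM.
by exists (M * N) => x; rewrite normrM ler_pM.
Qed.

Lemma bounded_measurableB f g : bounded_measurable f -> bounded_measurable g ->
  bounded_measurable (fun x => f x - g x).
Proof.
move=> bf bg; have -> : (fun x => f x - g x) = (fun x => f x + (-1) * g x).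
  by apply/funext => x; rewrite mulN1r.
apply: bounded_measurableD => //.
by apply: bounded_measurableM => //; exact: bounded_measurable_cst.
Qed.

Lemma bounded_measurable_ln f (a b : R) : 0 < a -> measurable_within a b f ->
  bounded_measurable (@ln R \o f).
Proof.
move=> a0 [mf fab]; exists (ln a), (ln b); split.
  exact: measurableT_comp (@measurable_ln R) mf.
move=> x; have /andP[af fb] := fab x.
have f0 := lt_le_trans a0 af; have b0 := lt_le_trans f0 fb.
by rewrite /= !ler_ln ?posrE// af.
Qed.

Lemma bounded_measurable_xlnx f (a b : R) : 0 <= a -> measurable_within a b f ->
  bounded_measurable (xlnx \o f).
Proof.
by move=> a0 fab; exists (- 1), (b ^+ 2); exact: measurable_within_xlnx a0 fab.
Qed.

Lemma bounded_measurable_integrable (P : probability T R) f :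
  bounded_measurable f -> P.-integrable setT (EFin \o f).
Proof. by move=> [a [b]]; exact: measurable_within_integrable. Qed.

End bounded_measurable.

Lemma bounded_measurable_comp (R : realType) d d' (T : measurableType d)
    (T' : measurableType d') (f : T' -> R) (h : T -> T') :
  measurable_fun setT h -> bounded_measurable f -> bounded_measurable (f \o h).
Proof.
move=> mh [a [b [mf fab]]]; exists a, b; split; first exact: measurableT_comp.
by move=> x; exact: fab.
Qed.

Section bounded_Rintegral.
Context (R : realType) d (T : measurableType d) (P : probability T R).
Implicit Types f g : T -> R.

Lemma bRintegralD f g : bounded_measurable f -> bounded_measurable g ->
  \int[P]_x (f x + g x) = \int[P]_x f x + \int[P]_x g x.
Proof.
by move=> bf bg; rewrite RintegralD//; exact: bounded_measurable_integrable.
Qed.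

Lemma bRintegralB f g : bounded_measurable f -> bounded_measurable g ->
  \int[P]_x (f x - g x) = \int[P]_x f x - \int[P]_x g x.
Proof.
by move=> bf bg; rewrite RintegralB//; exact: bounded_measurable_integrable.
Qed.

Lemma bRintegralZl f r : bounded_measurable f ->
  \int[P]_x (r * f x) = r * \int[P]_x f x.
Proof.
by move=> bf; rewrite RintegralZl//; exact: bounded_measurable_integrable.
Qed.

Lemma bRintegralZr f r : bounded_measurable f ->
  \int[P]_x (f x * r) = \int[P]_x f x * r.
Proof.
by move=> bf; rewrite RintegralZr//; exact: bounded_measurable_integrable.
Qed.

Lemma le_bRintegral f g : bounded_measurable f -> bounded_measurable g ->
  (forall x, f x <= g x) -> \int[P]_x f x <= \int[P]_x g x.
Proof.
by move=> bf bg fg; apply: le_Rintegral => //;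
  exact: bounded_measurable_integrable.
Qed.

End bounded_Rintegral.

(** * Entropy inequalities *)

Section entropy_inequalities.
Variable R : realType.

(** Integrate the tangent line at the mean of [u]. *)
Lemma jensen_xlnx d (T : measurableType d) (P : probability T R)
    (a b : R) (u : T -> R) :
  0 < a -> measurable_within a b u ->
  xlnx (\int[P]_x u x) <= \int[P]_x xlnx (u x).
Proof.
move=> a0 uab; set m := \int[P]_x u x.
have /andP[am mb] := Rintegral_within P uab.
have m0 : 0 < m := lt_le_trans a0 am.
have bu : bounded_measurable u by exists a, b.
have bxu : bounded_measurable (xlnx \o u).
  exact: bounded_measurable_xlnx (ltW a0) uab.
have bc c := bounded_measurable_cst T (c : R).
suff : \int[P]_x (u x - m) <= \int[P]_x (xlnx (u x) - u x * ln m).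
  rewrite !bRintegralB// ?bRintegralZr//; last exact: bounded_measurableM.
  by rewrite Rintegral_prob_cst -/m /xlnx; lra.
apply: le_bRintegral; [exact: bounded_measurableB| |].
  by apply: bounded_measurableB => //; exact: bounded_measurableM.
move=> x; apply: xlnx_tangent => //.
by case: uab => _ /(_ x) /andP[ax _]; rewrite (le_trans _ ax)// ltW.
Qed.

(** Nonnegativity of mutual information: for [w] of mean 1 this says that the
    joint entropy is at least the sum of the entropies of the marginals.  With
    [u], [v] the marginals and [m] the mean, integrate [xlnx_tangent_ratio] at
    [t = w]: its left-hand side [w - u v / m] has integral
    [m - m * m / m = 0]. *)
Lemma xlnx_marginals d1 d2 (X : measurableType d1) (Y : measurableType d2)
    (P : probability X R) (Q : probability Y R) (a b : R) (w : X * Y -> R) :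
  0 < a -> measurable_within a b w ->
  \int[P]_x xlnx (\int[Q]_y w (x, y)) + \int[Q]_y xlnx (\int[P]_x w (x, y)) <=
  \int[P]_x \int[Q]_y xlnx (w (x, y)) + xlnx (\int[P]_x \int[Q]_y w (x, y)).
Proof.
move=> a0 wab.
have arith (p q t : R) : 0 <= t - (p - q) -> p <= t + q by lra.
pose u x := \int[Q]_y w (x, y); pose v y := \int[P]_x w (x, y).
have uab : measurable_within a b u := measurable_within_marginal1 P Q wab.
have vab : measurable_within a b v := measurable_within_marginal2 P Q wab.
set m := \int[P]_x \int[Q]_y w (x, y).
have mE : m = \int[P]_x u x by [].
have mE' : m = \int[Q]_y v y by rewrite /m (Rintegral_swap P Q wab).
have /andP[am mb] := Rintegral_within P uab.
have m0 : 0 < m := lt_le_trans a0 am.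
have bw : bounded_measurable w by exists a, b.
have bu : bounded_measurable u by exists a, b.
have bv : bounded_measurable v by exists a, b.
have blu := bounded_measurable_ln a0 uab.
have blv := bounded_measurable_ln a0 vab.
have bxw : bounded_measurable (xlnx \o w).
  exact: bounded_measurable_xlnx (ltW a0) wab.
have b1 (f : X -> R) : bounded_measurable f ->
    bounded_measurable (fun z : X * Y => f z.1).
  by move=> bf; apply: (bounded_measurable_comp _ bf).
have b2 (f : Y -> R) : bounded_measurable f ->
    bounded_measurable (fun z : X * Y => f z.2).
  by move=> bf; apply: (bounded_measurable_comp _ bf).
have bp x : bounded_measurable (fun y => w (x, y)).
  by exists a, b; exact: measurable_within_pair1.
have bp' y : bounded_measurable (fun x => w (x, y)).
  by exists a, b; exact: measurable_within_pair2.
have bwu : bounded_measurable (fun z => w z * (@ln R \o u) z.1).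
  by apply: bounded_measurableM => //; exact: (b1 (@ln R \o u)).
have bwv : bounded_measurable (fun z => w z * (@ln R \o v) z.2).
  by apply: bounded_measurableM => //; exact: (b2 (@ln R \o v)).
have buv : bounded_measurable (fun z => u z.1 * v z.2).
  by apply: bounded_measurableM; [exact: (b1 u)|exact: (b2 v)].
have Ewu : \int[(P \x Q)%E]_z (w z * (@ln R \o u) z.1) = \int[P]_x xlnx (u x).
  have [c [e ce]] := bwu; rewrite (Rintegral_prod1 P Q ce) /=.
  by apply: eq_Rintegral => x _; rewrite bRintegralZr.
have Ewv : \int[(P \x Q)%E]_z (w z * (@ln R \o v) z.2) = \int[Q]_y xlnx (v y).
  have [c [e ce]] := bwv; rewrite (Rintegral_prod2 P Q ce) /=.
  by apply: eq_Rintegral => x _; rewrite bRintegralZr.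
have Euv : \int[(P \x Q)%E]_z (u z.1 * v z.2) = m * m.
  have [c [e ce]] := buv; rewrite (Rintegral_prod1 P Q ce) /=.
  rewrite {1}mE -(bRintegralZr _ _ bu); apply: eq_Rintegral => x _.
  by rewrite (bRintegralZl _ _ bv) -mE'.
have Ew : \int[(P \x Q)%E]_z w z = m by rewrite (Rintegral_prod1 P Q wab).
have Exw : \int[(P \x Q)%E]_z xlnx (w z) = \int[P]_x \int[Q]_y xlnx (w (x, y)).
  by have [c [e ce]] := bxw; exact: (Rintegral_prod1 P Q ce).
have bc c := bounded_measurable_cst (X * Y)%type (c : R).
suff : \int[(P \x Q)%E]_z (w z - (u z.1 * v z.2) * m^-1) <=
    \int[(P \x Q)%E]_z (xlnx (w z) -
      (w z * (@ln R \o u) z.1 + w z * (@ln R \o v) z.2 - w z * ln m)).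
  have bwm := bounded_measurableM bw (bc (ln m)).
  have buvm := bounded_measurableM buv (bc m^-1).
  have bD := bounded_measurableD bwu bwv.
  rewrite (bRintegralB _ bw buvm) (bRintegralZr _ _ buv).
  rewrite (bRintegralB _ bxw (bounded_measurableB bD bwm)).
  rewrite (bRintegralB _ bD bwm) (bRintegralD _ bwu bwv) (bRintegralZr _ _ bw).
  by rewrite Ewu Ewv Euv Ew Exw (mulfK (lt0r_neq0 m0)) subrr; exact: arith.
apply: le_bRintegral.
- by apply: bounded_measurableB => //; exact: bounded_measurableM.
- apply: bounded_measurableB => //; apply: bounded_measurableB.
    exact: bounded_measurableD.
  exact: bounded_measurableM.
move=> [x y] /=.
have gt0 (t : R) : a <= t <= b -> 0 < t.
  by move=> /andP[at_ _]; exact: lt_le_trans at_.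
have w0 : 0 < w (x, y) by apply: gt0; case: wab => _; exact.
have u0 : 0 < u x by apply: gt0; case: uab => _; exact.
have v0 : 0 < v y by apply: gt0; case: vab => _; exact.
exact: xlnx_tangent_ratio.
Qed.

End entropy_inequalities.

(** * Averaging over translations *)

Section shift_mean.
Variables (R : realType) (d : nat).
Implicit Types (mu nu : probability (borelRV R d) R) (g : borelRV R d -> R).

(** Convolution of functions with the reflection of [mu], as an operator.  It
    turns convolution of measures into composition of operators. *)
Definition shift_mean mu g : borelRV R d -> R :=
  fun s => \int[mu]_x g (add_borelRV (s, x)).

Lemma add_borelRVA (s x y : borelRV R d) :
  add_borelRV (add_borelRV (s, x), y) = add_borelRV (s, add_borelRV (x, y)).
Proof. by rewrite /add_borelRV/= addrA. Qed.

Lemma add_borelRVAC (s x y : borelRV R d) :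
  add_borelRV (add_borelRV (s, x), y) = add_borelRV (add_borelRV (s, y), x).
Proof. by rewrite /add_borelRV/= addrAC. Qed.

Lemma add_borelRV0 (x : borelRV R d) :
  add_borelRV ((0 : 'rV[R]_d) : borelRV R d, x) = x.
Proof. by rewrite /add_borelRV/= add0r. Qed.

Lemma measurable_within_add a b g : measurable_within a b g ->
  measurable_within a b (g \o @add_borelRV R d).
Proof.
move=> [mg gab]; split; last by move=> x; exact: gab.
exact: measurableT_comp mg (@measurable_add_borelRV R d).
Qed.

Lemma measurable_within_translate a b g (s : borelRV R d) :
  measurable_within a b g ->
  measurable_within a b (fun x => g (add_borelRV (s, x))).
Proof.
by move=> gab; exact: (measurable_within_pair1 (measurable_within_add gab)).
Qed.

Lemma measurable_within_translate2 a b g (s : borelRV R d) :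
  measurable_within a b g ->
  measurable_within a b (fun z => g (add_borelRV (add_borelRV (s, z.1), z.2))).
Proof.
move=> /(measurable_within_translate s)/measurable_within_add.
by congr measurable_within; apply/funext => -[x y]; rewrite /= add_borelRVA.
Qed.

Lemma shift_mean_within mu a b g :
  measurable_within a b g -> measurable_within a b (shift_mean mu g).
Proof.
move=> /measurable_within_add gab.
exact: (measurable_within_marginal1 mu mu gab).
Qed.

Lemma bounded_measurable_shift_mean mu g :
  bounded_measurable g -> bounded_measurable (shift_mean mu g).
Proof. by move=> [a [b gab]]; exists a, b; exact: shift_mean_within. Qed.

Lemma bounded_measurable_translate g (s : borelRV R d) :
  bounded_measurable g -> bounded_measurable (fun x => g (add_borelRV (s, x))).
Proof.
by move=> [a [b gab]]; exists a, b; exact: measurable_within_translate.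
Qed.

Lemma shift_mean_convolution mu nu g : bounded_measurable g ->
  shift_mean (convolution mu nu) g = shift_mean mu (shift_mean nu g).
Proof.
move=> [a [b gab]]; apply/funext => s.
have wab := measurable_within_translate2 s gab.
rewrite /shift_mean -(Rintegral_prod1 mu nu wab) /Rintegral; congr fine.
rewrite /convolution integral_distribution.
- by apply: eq_integral => -[x y] _ /=; rewrite add_borelRVA.
- apply/measurable_EFinP.
  by case: (measurable_within_translate s gab).
- apply: (@bounded_measurable_integrable _ _ _ (mu \x nu)%E
    (fun p => g (add_borelRV (s, add_borelRV p)))).
  exists a, b.
  exact: measurable_within_add (measurable_within_translate s gab).
Qed.

Lemma shift_mean_swap mu nu g : bounded_measurable g ->
  shift_mean mu (shift_mean nu g) = shift_mean nu (shift_mean mu g).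
Proof.
move=> [a [b gab]]; apply/funext => s.
have wab := measurable_within_translate2 s gab.
rewrite /shift_mean (Rintegral_swap mu nu wab)/=.
apply: eq_Rintegral => y _; apply: eq_Rintegral => x _.
by rewrite add_borelRVAC.
Qed.

Lemma shift_mean_dirac g : bounded_measurable g ->
  shift_mean (@dirac_origin R d) g = g.
Proof.
move=> bg; apply/funext => s.
rewrite /shift_mean /Rintegral /dirac_origin integral_dirac//.
  by rewrite diracT mul1e /= /add_borelRV/= addr0.
apply/measurable_EFinP.
by have /bounded_measurableP[] := bounded_measurable_translate s bg.
Qed.

Lemma shift_meanD_cst mu g (c : R) : bounded_measurable g ->
  shift_mean mu (fun x => g x + c) = (fun s => shift_mean mu g s + c).
Proof.
move=> bg; apply/funext => s; rewrite /shift_mean bRintegralD.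
- by rewrite Rintegral_prob_cst.
- exact: bounded_measurable_translate.
- exact: bounded_measurable_cst.
Qed.

Lemma le_shift_mean mu g h : bounded_measurable g -> bounded_measurable h ->
  (forall x, g x <= h x) -> forall s, shift_mean mu g s <= shift_mean mu h s.
Proof.
by move=> bg bh gh s; apply: le_bRintegral => //;
  exact: bounded_measurable_translate.
Qed.

(** The averaging operators are contractions for the sup norm. *)
Lemma shift_mean_dist mu g h (e : R) : bounded_measurable g ->
  bounded_measurable h -> (forall x, `|g x - h x| <= e) ->
  forall s, `|shift_mean mu g s - shift_mean mu h s| <= e.
Proof.
move=> bg bh ghe s; have bgs := bounded_measurable_translate s bg.
have bhs := bounded_measurable_translate s bh.
rewrite /shift_mean -bRintegralB// ler_norml.
apply: (Rintegral_within mu); split.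
  by have /bounded_measurableP[] := bounded_measurableB bgs bhs.
by move=> x; rewrite -ler_norml.
Qed.

Lemma shift_meanD mu g h : bounded_measurable g -> bounded_measurable h ->
  shift_mean mu (fun x => g x + h x) =
  (fun s => shift_mean mu g s + shift_mean mu h s).
Proof.
move=> bg bh; apply/funext => s; rewrite /shift_mean bRintegralD//;
  exact: bounded_measurable_translate.
Qed.

(** The next two lemmas are [jensen_xlnx] and [xlnx_marginals] for the functions
    [x |-> g (s + x)] and [(x, y) |-> g (s + x + y)]. *)
Lemma shift_mean_xlnx mu (a b : R) g : 0 < a -> measurable_within a b g ->
  forall s, xlnx (shift_mean mu g s) <= shift_mean mu (xlnx \o g) s.
Proof.
by move=> a0 gab s; exact: jensen_xlnx (measurable_within_translate s gab).
Qed.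

Lemma shift_mean_xlnx2 mu nu (a b : R) g : 0 < a -> measurable_within a b g ->
  forall s,
  shift_mean mu (xlnx \o shift_mean nu g) s +
    shift_mean nu (xlnx \o shift_mean mu g) s <=
  shift_mean mu (shift_mean nu (xlnx \o g)) s +
    xlnx (shift_mean mu (shift_mean nu g) s).
Proof.
move=> a0 gab s.
rewrite [X in _ + X <= _](_ : _ = \int[nu]_y xlnx (\int[mu]_x
    g (add_borelRV (add_borelRV (s, x), y)))); last first.
  apply: eq_Rintegral => y _; congr xlnx; apply: eq_Rintegral => x _.
  by rewrite add_borelRVAC.
have H := xlnx_marginals mu nu a0 (measurable_within_translate2 s gab).
exact: H.
Qed.

End shift_mean.

(** * Test functions *)

Section test_functions.
Variables (R : realType) (d : nat).
Implicit Types (f : 'rV[R]_d -> R) (y : 'rV[R]_d).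

Lemma derive_translate f y v x :
  'D_v (fun z : 'rV[R]_d => f (y + z)) x = 'D_v f (y + x).
Proof.
rewrite /derive; do 2 f_equal.
by apply/funext => h /=; rewrite addrCA.
Qed.

Lemma derivable_translate f y v x :
  derivable f (y + x) v -> derivable (fun z => f (y + z)) x v.
Proof.
rewrite /derivable.
suff -> : (fun h => h^-1 *:
    (((fun z => f (y + z)) \o shift x) (h *: v) - f (y + x))) =
  (fun h : R => h^-1 *: ((f \o shift (y + x)) (h *: v) - f (y + x))) by [].
by apply/funext => h /=; rewrite addrCA.
Qed.

Lemma partials_translate f y s :
  partials s (fun x => f (y + x)) = (fun x => partials s f (y + x)).
Proof.
elim: s => //= i s ->; apply/funext => x.
exact: (derive_translate (partials s f)).
Qed.

Lemma continuous_translate y : continuous (fun x : 'rV[R]_d => y + x).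
Proof.
move=> x; apply: (@continuousD R _ _ (fun=> y) id) => /=.
  exact: cst_continuous.
exact: cvg_id.
Qed.

Lemma smooth_translate f y : smooth f -> smooth (fun x => f (y + x)).
Proof.
move=> sf s; have [cf df] := sf s; rewrite partials_translate; split=> [x|i x].
  apply: (@continuous_comp _ _ _ (fun x : 'rV[R]_d => y + x) (partials s f)).
    exact: continuous_translate.
  exact: cf.
exact: derivable_translate.
Qed.

(** The support of a translate lies in the translate of the support, which is
    compact, hence closed. *)
Lemma compactly_supported_translate f y :
  compactly_supported f -> compactly_supported (fun x => f (y + x)).
Proof.
move=> cf.
pose K := (fun x : 'rV[R]_d => - y + x) @` closure [set x | f x != 0].
have cK : compact K.
  apply: continuous_compact => //; apply: continuous_subspaceT.
  exact: continuous_translate.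
apply: (subclosed_compact (@closed_closure _ _) cK).
have clK : closed K := compact_closed (@norm_hausdorff _ _) cK.
rewrite [X in _ `<=` X](closure_id K).1//.
apply: closure_subset => x /= fx.
exists (y + x); last by rewrite addKr.
exact: subset_closure.
Qed.

Lemma gradient_translate f y x :
  gradient (fun z => f (y + z)) x = gradient f (y + x).
Proof. by apply/rowP => i; rewrite !mxE; exact: derive_translate. Qed.

Lemma continuous_borelRV_measurable f : continuous f ->
  measurable_fun setT (f : borelRV R d -> R).
Proof.
move=> cf.
apply: (measurability _ (RGenOpens.measurableE R)) => _ [_ [a [b ->] <-]].
rewrite setTI; apply: sub_sigma_algebra.
by apply: open_comp => // x _; exact: cf.
Qed.

Lemma bounded_measurable_compact f (K : set 'rV[R]_d) :
  continuous f -> compact K -> (forall x, ~ K x -> f x = 0) ->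
  bounded_measurable (f : borelRV R d -> R).
Proof.
move=> cf cK f0; apply/bounded_measurableP; split.
  exact: continuous_borelRV_measurable.
have /compact_bounded[M [_ MP]] : compact (f @` K).
  by apply: continuous_compact => //; exact: continuous_subspaceT.
exists (`|M| + 1) => x; case: (pselect (K x)) => [Kx|/f0->].
  by apply: (MP (`|M| + 1)); [rewrite (le_lt_trans (ler_norm M))// ltrDl|
    exists x].
by rewrite normr0 addr_ge0.
Qed.

(** [f] vanishes near [x], since the complement of its support is open. *)
Lemma derive_outside_support f x v :
  ~ closure [set x | f x != 0] x -> 'D_v f x = 0.
Proof.
move=> nKx; have -> : 'D_v f x = 'D_v (cst 0) x.
  apply: near_eq_derive.
  have oC : open (~` closure [set x | f x != 0]).
    exact/closed_openC/closed_closure.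
  have : nbhs x (~` closure [set x | f x != 0]) by exact: open_nbhs_nbhs.
  apply: filterS => z nKz /=; apply/eqP/negPn/negP => fz.
  exact/nKz/subset_closure.
exact: derive_cst.
Qed.

Definition gradient_sqnorm f : borelRV R d -> R :=
  fun x => euclidean_norm (gradient f x) ^+ 2.

Section test.
Variable f : 'rV[R]_d -> R.
Hypotheses (sf : smooth f) (cf : compactly_supported f).

Lemma bounded_measurable_test : bounded_measurable (f : borelRV R d -> R).
Proof.
apply: (bounded_measurable_compact (proj1 (sf [::])) cf) => x nKx.
by apply/eqP/negPn/negP => fx; exact/nKx/subset_closure.
Qed.

Lemma bounded_measurable_gradient_sqnorm :
  bounded_measurable (gradient_sqnorm f).
Proof.
have -> : gradient_sqnorm f =
    (fun x => \sum_(i < d) 'D_(delta_mx 0 i) f x ^+ 2).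
  apply/funext => x; rewrite /gradient_sqnorm sqr_sqrtr ?sumr_ge0//.
    by apply: eq_bigr => i _; rewrite mxE.
  by move=> i _; rewrite sqr_ge0.
have bD i : bounded_measurable ('D_(delta_mx 0 i) f : borelRV R d -> R).
  apply: (bounded_measurable_compact (proj1 (sf [:: i])) cf) => x.
  exact: derive_outside_support.
elim: (index_enum _) => [|i r IHr].
  by under eq_fun do rewrite big_nil; exact: bounded_measurable_cst.
under eq_fun do rewrite big_cons.
by apply: bounded_measurableD => //; exact: bounded_measurableM.
Qed.

Lemma test_sq_within : exists M, measurable_within 0 M
  ((fun x => f x ^+ 2) : borelRV R d -> R).
Proof.
have bf := bounded_measurable_test.
have [a [b [mf2 f2b]]] := bounded_measurableM bf bf.
exists b; split=> // x; rewrite sqr_ge0/=.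
by have /andP[_] := f2b x.
Qed.

End test.
End test_functions.

Section log_sobolev.
Variables (R : realType) (d : nat).
Implicit Types (mu : probability (borelRV R d) R) (f : 'rV[R]_d -> R).

Lemma log_sobolev_constant_ge0 mu : (0 <= log_sobolev_constant mu)%E.
Proof. by apply: le_ereal_inf_tmp => _ [C [C0 _] <-]; rewrite lee_fin. Qed.

(** The admissible constants form a closed set, the inequality being continuous
    in the constant; so the infimum is itself admissible. *)
Lemma log_sobolev_constant_attained mu (c : R) :
  log_sobolev_constant mu = c%:E -> log_sobolev mu c.
Proof.
move=> mc f sf cf.
set E := entropy _ _; set I := \int[mu]_x _.
have I0 : 0 <= I by apply: Rintegral_ge0 => x _; rewrite sqr_ge0.
apply/ler_addgt0Pr => e e0.
(* chosen so that [2 * t * I <= e] *)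
pose t := e / (2 * (I + 1)).
have t0 : 0 < t by rewrite divr_gt0// mulr_gt0//; lra.
have : (log_sobolev_constant mu < (c + t)%:E)%E by rewrite mc lte_fin; lra.
move=> /ereal_inf_lt[_ [C [C0 muC] <-]]; rewrite lte_fin => Cct {mc}.
apply: (le_trans (muC f sf cf)); rewrite -/I.
have -> : e = 2 * t * (I + 1) by rewrite /t; field; lra.
have h1 : C * I <= (c + t) * I by rewrite ler_wpM2r// ltW.
lra.
Qed.

End log_sobolev.

(** * Averaging over subfamilies *)

Local Close Scope classical_set_scope.
Import mathcomp.boot.finset.

Section convolution_family.
Variables (R : realType) (d n : nat) (mu : 'I_n -> probability (borelRV R d) R).
Implicit Types (g : borelRV R d -> R) (S : {set 'I_n}).

Definition family_mean S := shift_mean (convolution_family mu S).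

(** Convolution is associative and commutative only in the sense that the
    associated operators agree on bounded measurable functions, as this is all
    that Fubini gives; so the splitting of a family into two disjoint parts is
    proved for operators, by induction on the list of indices. *)
Lemma shift_mean_big_split (r : seq 'I_n) (p p1 p2 : pred 'I_n) g :
  (forall i, p i = p1 i || p2 i) -> (forall i, ~~ (p1 i && p2 i)) ->
  bounded_measurable g ->
  shift_mean (\big[@convolution R d/dirac_origin R d]_(i <- r | p i) mu i) g =
  shift_mean (\big[@convolution R d/dirac_origin R d]_(i <- r | p1 i) mu i)
    (shift_mean (\big[@convolution R d/dirac_origin R d]_(i <- r | p2 i) mu i)
      g).
Proof.
move=> pE p12 bg; elim: r => [|i r IHr].
  rewrite !big_nil.
  exact/esym/shift_mean_dirac/bounded_measurable_shift_mean.
rewrite !big_cons pE; move: (p12 i).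
case: (p1 i); case: (p2 i).
- by move=> /negP[].
- move=> _; rewrite (shift_mean_convolution _ _ bg) IHr.
  exact/esym/shift_mean_convolution/bounded_measurable_shift_mean.
- move=> _; rewrite !(shift_mean_convolution _ _ bg) IHr.
  exact/shift_mean_swap/bounded_measurable_shift_mean.
- move=> _; exact: IHr.
Qed.

Lemma family_meanU S1 S2 g : [disjoint S1 & S2] -> bounded_measurable g ->
  family_mean (S1 :|: S2) g = family_mean S1 (family_mean S2 g).
Proof.
move=> S12 bg; apply: shift_mean_big_split => // i; first by rewrite inE.
apply/negP => /andP[iS1 iS2]; move/pred0P: S12 => /(_ i)/=.
by rewrite iS1 iS2.
Qed.

Lemma family_mean0 g : bounded_measurable g -> family_mean set0 g = g.
Proof.
move=> bg; rewrite /family_mean /convolution_family big_set0.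
exact: shift_mean_dirac.
Qed.

End convolution_family.

(** * Shearer's inequality for submodular functions *)

Section shearer.
Variables (R : realType) (n : nat) (D : {set 'I_n} -> R) (r : {set 'I_n} -> R).
Hypothesis D0 : D set0 = 0.
Hypothesis D_mono : forall S T : {set 'I_n}, S \subset T -> D S <= D T.
Hypothesis D_submod : forall S T : {set 'I_n},
  D (S :|: T) + D (S :&: T) <= D S + D T.
Hypothesis r_ge0 : forall S : {set 'I_n}, 0 <= r S.
Hypothesis r_cover : forall i : 'I_n, 1 <= \sum_(S : {set 'I_n} | i \in S) r S.

(* initial segments of the index set, along which increments are taken *)
Let below (k : nat) : {set 'I_n} := [set i : 'I_n | (i < k)%N].

(** Write [delta k] for the [k]-th increment of [D] along the initial segments.
    Submodularity gives [D S >= \sum_(k in S) delta k]; after summing against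
    [r], each [delta k >= 0] is counted with total weight at least 1. *)
Lemma shearer_submodular : D [set: 'I_n] <= \sum_(S : {set 'I_n}) r S * D S.
Proof.
pose delta k := D (below k.+1) - D (below k).
have delta_ge0 k : 0 <= delta k.
  rewrite subr_ge0; apply: D_mono.
  by apply/fintype.subsetP => i; rewrite !inE; apply: ltnW.
have b0 : below 0 = set0 by apply/setP => i; rewrite !inE ltn0.
have bn : below n = [set: 'I_n] by apply/setP => i; rewrite !inE ltn_ord.
have tele (F : nat -> R) : F n - F 0%N = \sum_(k < n) (F k.+1 - F k).
  by rewrite -(big_mkord xpredT (fun k => F k.+1 - F k)) telescope_sumr.
have marginal (S : {set 'I_n}) (k : 'I_n) :
    (k \in S)%:R * delta k <= D (S :&: below k.+1) - D (S :&: below k).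
  case: (boolP (k \in S)) => kS; last first.
    rewrite mul0r subr_ge0; apply: D_mono; apply: setIS.
    by apply/fintype.subsetP => i; rewrite !inE; apply: ltnW.
  (* for [k \in S] the union of these two sets is [below k.+1] *)
  have := D_submod (S :&: below k.+1) (below k).
  have -> : (S :&: below k.+1) :&: below k = S :&: below k.
    rewrite -setIA; congr (_ :&: _); apply/setP => i; rewrite !inE ltnS.
    by case: ltnP => [/ltnW->|]; rewrite ?andbF.
  suff bkD : D (below k.+1) <= D ((S :&: below k.+1) :|: below k).
    by rewrite mul1r /delta; lra.
  apply: D_mono; apply/fintype.subsetP => i; rewrite !inE !ltnS leq_eqVlt.
  by case/orP => [/eqP/val_inj->|->]; rewrite ?kS ?eqxx ?orbT.
have DS (S : {set 'I_n}) : \sum_(k < n) (k \in S)%:R * delta k <= D S.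
  rewrite (le_trans (ler_sum _ (fun k _ => marginal S k)))//.
  rewrite -(tele (fun k => D (S :&: below k))) b0 bn setI0 D0 subr0.
  by rewrite setIT.
have : \sum_(S : {set 'I_n}) r S * (\sum_(k < n) (k \in S)%:R * delta k) <=
    \sum_(S : {set 'I_n}) r S * D S.
  by apply: ler_sum => S _; rewrite ler_wpM2l.
apply: le_trans.
under eq_bigr do rewrite mulr_sumr.
rewrite exchange_big/=.
have -> : D [set: 'I_n] = \sum_(k < n) delta k.
  by rewrite -(tele (fun k => D (below k))) b0 bn D0 subr0.
apply: ler_sum => k _.
under eq_bigr do rewrite mulrA.
rewrite -mulr_suml -[leLHS]mul1r ler_wpM2r//.
rewrite (le_trans (r_cover k))// big_mkcond/= ler_sum// => S _.
by case: ifP; rewrite ?mulr1 ?mulr0.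
Qed.

End shearer.

(** * Entropy along subfamilies *)

Lemma disjointI (T : finType) (X Y : {set T}) :
  (forall i, ~~ ((i \in X) && (i \in Y))) -> [disjoint X & Y].
Proof. by move=> XY; apply/pred0P => i; apply/negbTE/XY. Qed.

Section entropy_drop.
Variables (R : realType) (d n : nat) (mu : 'I_n -> probability (borelRV R d) R).
Implicit Types (g : borelRV R d -> R) (S T : {set 'I_n}).
Local Notation T_ := (family_mean mu).
Local Notation origin := ((0 : 'rV[R]_d) : borelRV R d).

(** The expected entropy of [g (X_1 + ... + X_n)] in the variables of index in
    [S], the others being frozen: as [T_ setT] is [T_ (~: S)] after [T_ S], this
    is the [T_ (~: S)]-average at the origin of
    [T_ S (xlnx \o g) - xlnx \o T_ S g].  In this form it is a difference of
    two averages of which only the second depends on [S]. *)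
Definition entropy_drop g S : R :=
  T_ [set: 'I_n] (xlnx \o g) origin - T_ (~: S) (xlnx \o T_ S g) origin.

Lemma entropy_drop0 g a b : 0 <= a -> measurable_within a b g ->
  entropy_drop g set0 = 0.
Proof.
move=> a0 gab; have bg : bounded_measurable g by exists a, b.
by rewrite /entropy_drop family_mean0// setC0 subrr.
Qed.

Section positive.
Variables (a b : R) (g : borelRV R d -> R).
Hypotheses (a0 : 0 < a) (gab : measurable_within a b g).

Let bg : bounded_measurable g. Proof. by exists a, b. Qed.

(** Freezing fewer variables increases the entropy, by Jensen's inequality for
    the variables of index in [T :\: S]. *)
Lemma entropy_drop_mono S T :
  S \subset T -> entropy_drop g S <= entropy_drop g T.
Proof.
move=> ST; rewrite /entropy_drop lerD2l lerN2.
have TE : T = (T :\: S) :|: S.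
  apply/setP => i; rewrite !inE; have := fintype.subsetP ST i.
  by case: (i \in S) (i \in T) => -[] // ->.
have SE : ~: S = ~: T :|: (T :\: S).
  apply/setP => i; rewrite !inE; have := fintype.subsetP ST i.
  by case: (i \in S) (i \in T) => -[] // ->.
have dTS : [disjoint T :\: S & S].
  by apply: disjointI => i; rewrite !inE; case: (i \in S) (i \in T) => -[].
have dCT : [disjoint ~: T & T :\: S].
  by apply: disjointI => i; rewrite !inE; case: (i \in S) (i \in T) => -[].
have uab : measurable_within a b (T_ S g) by exact: shift_mean_within.
have bu := bounded_measurable_xlnx (ltW a0) uab.
rewrite SE [X in T_ X g]TE !family_meanU//; apply: le_shift_mean.
- exact: (bounded_measurable_xlnx (ltW a0) (shift_mean_within _ uab)).
- exact: bounded_measurable_shift_mean.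
- exact: shift_mean_xlnx a0 uab.
Qed.

(** Average first over [S :&: T], obtaining [u]; the inequality is then that of
    [shift_mean_xlnx2] for the disjoint groups [A = S :\: T] and
    [B = T :\: S], averaged over the indices outside [S :|: T]. *)
Lemma entropy_drop_submod S T :
  entropy_drop g (S :|: T) + entropy_drop g (S :&: T) <=
  entropy_drop g S + entropy_drop g T.
Proof.
rewrite /entropy_drop.
pose U := S :&: T; pose A := S :\: T; pose B := T :\: S; pose Q := ~: (S :|: T).
have SE : S = A :|: U by rewrite setUC /U /A setID.
have TE : T = B :|: U by rewrite setUC /U /B setIC setID.
have STE : S :|: T = A :|: (B :|: U).
  by apply/setP => i; rewrite !inE; case: (i \in S) (i \in T) => -[].
have CSE : ~: S = Q :|: B.
  by apply/setP => i; rewrite !inE; case: (i \in S) (i \in T) => -[].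
have CTE : ~: T = Q :|: A.
  by apply/setP => i; rewrite !inE; case: (i \in S) (i \in T) => -[].
have CIE : ~: U = Q :|: (A :|: B).
  by apply/setP => i; rewrite !inE; case: (i \in S) (i \in T) => -[].
have dAU : [disjoint A & U].
  by apply: disjointI => i; rewrite !inE; case: (i \in S) (i \in T) => -[].
have dBU : [disjoint B & U].
  by apply: disjointI => i; rewrite !inE; case: (i \in S) (i \in T) => -[].
have dABU : [disjoint A & B :|: U].
  by apply: disjointI => i; rewrite !inE; case: (i \in S) (i \in T) => -[].
have dQA : [disjoint Q & A].
  by apply: disjointI => i; rewrite !inE; case: (i \in S) (i \in T) => -[].
have dQB : [disjoint Q & B].
  by apply: disjointI => i; rewrite !inE; case: (i \in S) (i \in T) => -[].
have dQAB : [disjoint Q & A :|: B].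
  by apply: disjointI => i; rewrite !inE; case: (i \in S) (i \in T) => -[].
have dAB : [disjoint A & B].
  by apply: disjointI => i; rewrite !inE; case: (i \in S) (i \in T) => -[].
set u := T_ U g.
have uab : measurable_within a b u by exact: shift_mean_within.
have bxu := bounded_measurable_xlnx (ltW a0) uab.
have xw X (h : borelRV R d -> R) :
    measurable_within a b h -> bounded_measurable (xlnx \o T_ X h).
  move=> hab.
  exact: (bounded_measurable_xlnx (ltW a0) (shift_mean_within _ hab)).
have TS : T_ S g = T_ A u by rewrite {1}SE family_meanU.
have TT : T_ T g = T_ B u by rewrite {1}TE family_meanU.
have TST : T_ (S :|: T) g = T_ A (T_ B u).
  rewrite STE -[T_ B u](family_meanU mu dBU bg).
  exact: (family_meanU mu dABU bg).
have uBab : measurable_within a b (T_ B u) by exact: shift_mean_within.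
have bAB : bounded_measurable (T_ A (T_ B (xlnx \o u))).
  by do 2 apply: bounded_measurable_shift_mean.
have bA : bounded_measurable (T_ A (xlnx \o T_ B u)).
  by apply: bounded_measurable_shift_mean; exact: xw.
have bB : bounded_measurable (T_ B (xlnx \o T_ A u)).
  by apply: bounded_measurable_shift_mean; exact: xw.
have xST : bounded_measurable (xlnx \o T_ A (T_ B u)) := xw A _ uBab.
have xA : bounded_measurable (xlnx \o T_ A u) := xw A _ uab.
have xB : bounded_measurable (xlnx \o T_ B u) := xw B _ uab.
have : T_ Q (fun s => T_ A (xlnx \o T_ B u) s + T_ B (xlnx \o T_ A u) s) origin
    <= T_ Q (fun s => T_ A (T_ B (xlnx \o u)) s + (xlnx \o T_ A (T_ B u)) s)
         origin.
  apply: (le_shift_mean _ (bounded_measurableD bA bB)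
    (bounded_measurableD bAB xST)).
  exact: shift_mean_xlnx2 a0 uab.
rewrite [X in X <= _](congr1 (@^~ _) (shift_meanD _ bA bB)).
rewrite [X in _ <= X](congr1 (@^~ _) (shift_meanD _ bAB xST)).
rewrite TS TT TST CSE CTE CIE -/u.
rewrite [T_ (Q :|: B) _](family_meanU mu dQB xA).
rewrite [T_ (Q :|: A) _](family_meanU mu dQA xB).
rewrite [T_ (Q :|: (A :|: B)) _](family_meanU mu dQAB bxu).
rewrite [T_ (A :|: B) _](family_meanU mu dAB bxu).
have arith (p x y z t : R) :
    x + y <= z + t -> p - t + (p - z) <= p - y + (p - x) by lra.
exact: arith.
Qed.

Lemma entropy_drop_shearer_pos (r : {set 'I_n} -> R) :
  (forall S, 0 <= r S) ->
  (forall i : 'I_n, 1 <= \sum_(S : {set 'I_n} | i \in S) r S) ->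
  entropy_drop g [set: 'I_n] <= \sum_(S : {set 'I_n}) r S * entropy_drop g S.
Proof.
move=> r0 r1; apply: shearer_submodular => //.
- exact: entropy_drop0 (ltW a0) gab.
- exact: entropy_drop_mono.
- exact: entropy_drop_submod.
Qed.

End positive.

(** Averaging commutes with adding a constant, so both terms of the difference
    move by at most the amount in [xlnx_perturb]. *)
Lemma entropy_drop_perturb M e g S : measurable_within 0 M g -> 0 < e <= 1 ->
  `|entropy_drop (fun x => g x + e ^+ 2) S - entropy_drop g S| <=
  2 * ((M + 2) * e).
Proof.
move=> gM /[dup] e01 /andP[e0 e1].
have bg : bounded_measurable g by exists 0, M.
have bcg (h : borelRV R d -> R) : measurable_within 0 M h ->
    bounded_measurable (fun x => xlnx (h x + e ^+ 2)).
  move=> [mh hM].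
  have hab : measurable_within 0 (M + e ^+ 2) (fun x => h x + e ^+ 2).
    split; first exact: measurable_funD.
    by move=> x; have /andP[? ?] := hM x; have := sqr_ge0 e; lra.
  exact: (bounded_measurable_xlnx (lexx 0) hab).
have TSE : T_ S (fun x => g x + e ^+ 2) = (fun s => T_ S g s + e ^+ 2).
  exact: shift_meanD_cst.
have close X (h : borelRV R d -> R) : measurable_within 0 M h -> forall s,
    `|T_ X (fun x => xlnx (h x + e ^+ 2)) s - T_ X (xlnx \o h) s| <=
    (M + 2) * e.
  move=> hM.
  apply: (@shift_mean_dist _ _ _ (fun x => xlnx (h x + e ^+ 2)) (xlnx \o h)).
  - exact: bcg.
  - exact: bounded_measurable_xlnx (lexx 0) hM.
  - by move=> x; apply: xlnx_perturb => //; case: hM => _; exact.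
have arith (p p' q q' k : R) :
    `|p - p'| <= k -> `|q - q'| <= k -> `|p - q - (p' - q')| <= 2 * k.
  rewrite !ler_norml => /andP[? ?] /andP[? ?].
  by apply/andP; split; lra.
rewrite /entropy_drop TSE; apply: arith.
  exact: (close [set: 'I_n] g gM).
exact: (close (~: S) (T_ S g) (shift_mean_within _ gM)).
Qed.

(** Passage to functions that may vanish: apply the positive case to
    [g + e ^+ 2], where the error is [K * e] with [K] independent of [e], and
    let [e] tend to 0. *)
Lemma entropy_drop_shearer (M : R) g (r : {set 'I_n} -> R) :
  measurable_within 0 M g ->
  (forall S, 0 <= r S) ->
  (forall i : 'I_n, 1 <= \sum_(S : {set 'I_n} | i \in S) r S) ->
  entropy_drop g [set: 'I_n] <= \sum_(S : {set 'I_n}) r S * entropy_drop g S.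
Proof.
move=> gM r0 r1.
have M0 : 0 <= M by case: gM => _ /(_ 0) /andP[]; exact: le_trans.
pose K := 2 * (M + 2) * (1 + \sum_(S : {set 'I_n}) r S).
have sr0 : 0 <= \sum_(S : {set 'I_n}) r S by rewrite sumr_ge0.
have K0 : 0 < K by rewrite !mulr_gt0//; lra.
suff H e : 0 < e <= 1 -> entropy_drop g [set: 'I_n] <=
    \sum_(S : {set 'I_n}) r S * entropy_drop g S + K * e.
  apply/ler_addgt0Pr => t t0.
  pose e := Num.min 1 (t / K).
  have e01 : 0 < e <= 1 by rewrite lt_min ltr01 divr_gt0// ge_min lexx.
  rewrite (le_trans (H _ e01))// lerD2l.
  by rewrite -(ler_pdivlMl _ _ K0) mulrC ge_min lexx orbT.
move=> e01; have /andP[e0 e1] := e01.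
have gpos : measurable_within (e ^+ 2) (M + e ^+ 2) (fun x => g x + e ^+ 2).
  case: gM => mg gM; split; first exact: measurable_funD.
  by move=> x; have /andP[? ?] := gM x; lra.
have e20 : 0 < e ^+ 2 by rewrite exprn_gt0.
have main := entropy_drop_shearer_pos e20 gpos r0 r1.
have pert S := entropy_drop_perturb S gM e01.
pose k := 2 * ((M + 2) * e).
have le_dist (x y : R) : `|x - y| <= k -> x <= y + k /\ y <= x + k.
  by rewrite ler_norml => /andP[? ?]; split; lra.
have -> : K * e = \sum_(S : {set 'I_n}) r S * k + k.
  by rewrite -mulr_suml /K /k; ring.
rewrite addrA -big_split/=.
apply: (le_trans (proj2 (le_dist _ _ (pert [set: 'I_n])))).
rewrite lerD2r (le_trans main)// ler_sum// => S _.
rewrite -mulrDr ler_wpM2l//.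
exact: (proj1 (le_dist _ _ (pert S))).
Qed.

End entropy_drop.

(** * The log-Sobolev inequality along subfamilies *)

Section log_sobolev_family.
Variables (R : realType) (d n : nat) (mu : 'I_n -> probability (borelRV R d) R).
Local Notation T_ := (family_mean mu).
Local Notation origin := ((0 : 'rV[R]_d) : borelRV R d).

Lemma entropy_drop_full (g : borelRV R d -> R) a b :
  0 <= a -> measurable_within a b g ->
  entropy_drop mu g [set: 'I_n] = entropy (convolution_family mu [set: 'I_n]) g.
Proof.
move=> a0 gab; have bg : bounded_measurable g by exists a, b.
have bxT : bounded_measurable (xlnx \o T_ [set: 'I_n] g).
  exact: (bounded_measurable_xlnx a0 (shift_mean_within _ gab)).
rewrite /entropy_drop setCT (family_mean0 mu bxT) /entropy.
rewrite /family_mean /shift_mean /=.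
congr (_ - _).
  by apply: eq_Rintegral => x _; rewrite add_borelRV0.
rewrite /xlnx; congr (_ * ln _);
  by apply: eq_Rintegral => x _; rewrite add_borelRV0.
Qed.

(** For each value [y] of the frozen part, the log-Sobolev inequality of [mu_S]
    is applied to the test function [f (y + .)]; averaging over [y] turns the
    gradient term into an integral against the full convolution. *)
Lemma entropy_drop_log_sobolev (f : 'rV[R]_d -> R) (S : {set 'I_n}) (C : R) :
  smooth f -> compactly_supported f ->
  log_sobolev (convolution_family mu S) C ->
  entropy_drop mu (fun x => f x ^+ 2) S <=
  2 * C * \int[convolution_family mu [set: 'I_n]]_x
    (euclidean_norm (gradient f x) ^+ 2).
Proof.
move=> sf cf muC.
have [M gM] := test_sq_within sf cf.
have bh := bounded_measurable_gradient_sqnorm sf cf.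
set g : borelRV R d -> R := fun x => f x ^+ 2 in gM *.
set h := gradient_sqnorm f in bh.
have bg : bounded_measurable g by exists 0, M.
have bxg : bounded_measurable (xlnx \o g).
  exact: bounded_measurable_xlnx (lexx 0) gM.
have gSM : measurable_within 0 M (T_ S g) by exact: shift_mean_within.
have bxS : bounded_measurable (xlnx \o T_ S g).
  exact: bounded_measurable_xlnx (lexx 0) gSM.
have bhS : bounded_measurable (T_ S h) by exact: bounded_measurable_shift_mean.
have bxgS : bounded_measurable (T_ S (xlnx \o g)).
  exact: bounded_measurable_shift_mean.
have b2C : bounded_measurable (fun _ : borelRV R d => 2 * C).
  exact: bounded_measurable_cst.
have pointwise (y : borelRV R d) :
    T_ S (xlnx \o g) y <= xlnx (T_ S g y) + 2 * C * T_ S h y.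
  have Egrad : \int[convolution_family mu S]_x
      (euclidean_norm (gradient (fun z => f ((y : 'rV[R]_d) + z)) x) ^+ 2) =
      T_ S h y.
    by apply: eq_Rintegral => x _; rewrite gradient_translate.
  have := muC _ (@smooth_translate R d f y sf)
    (@compactly_supported_translate R d f y cf).
  rewrite Egrad => H.
  rewrite -lerBlDl.
  exact: H.
have disjC : [disjoint ~: S & S].
  by apply: disjointI => i; rewrite !inE; case: (i \in S).
have full (k : borelRV R d -> R) : bounded_measurable k ->
    T_ [set: 'I_n] k = T_ (~: S) (T_ S k).
  by move=> bk; rewrite -(family_meanU mu disjC bk) setUC setUCr.
have Eh : T_ [set: 'I_n] h origin = \int[convolution_family mu [set: 'I_n]]_x
    (euclidean_norm (gradient f x) ^+ 2).
  by apply: eq_Rintegral => x _; rewrite add_borelRV0.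
have bCh := bounded_measurableM b2C bhS.
have key : T_ (~: S) (T_ S (xlnx \o g)) origin <=
    T_ (~: S) (fun y => (xlnx \o T_ S g) y + 2 * C * T_ S h y) origin.
  exact: (le_shift_mean _ bxgS (bounded_measurableD bxS bCh) pointwise).
have keyE : T_ (~: S) (fun y => (xlnx \o T_ S g) y + 2 * C * T_ S h y) origin =
    T_ (~: S) (xlnx \o T_ S g) origin + 2 * C * T_ (~: S) (T_ S h) origin.
  rewrite [LHS](congr1 (@^~ _) (shift_meanD _ bxS bCh)); congr (_ + _).
  exact: (bRintegralZl _ _ (bounded_measurable_translate origin bhS)).
rewrite -Eh (full h bh) /entropy_drop (full _ bxg) lerBlDl -keyE.
exact: key.
Qed.

End log_sobolev_family.

Theorem theorem1p2 (R : realType) (n d : nat) (n_ge1 : (1 <= n)%N)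
    (d_ge1 : (1 <= d)%N)
    (mu : 'I_n -> probability (borelRV R d) R) (r : {set 'I_n} -> R)
    (r_ge0 : forall S : {set 'I_n}, 0 <= r S)
    (r_cover : forall i : 'I_n, 1 <= \sum_(S : {set 'I_n} | i \in S) r S) :
  (log_sobolev_constant (convolution_family mu [set: 'I_n]) <=
    \sum_(S : {set 'I_n})
      (r S)%:E * log_sobolev_constant (convolution_family mu S))%E.
Proof.
pose CLS (S : {set 'I_n}) := log_sobolev_constant (convolution_family mu S).
have CLS0 S : (0 <= CLS S)%E by exact: log_sobolev_constant_ge0.
have term0 S : (0 <= (r S)%:E * CLS S)%E by rewrite mule_ge0// lee_fin.
(* An infinite constant of positive weight makes the whole sum infinite. *)
have [[S [rS CS]]|nocase] :=
    pselect (exists S, 0 < r S /\ CLS S = +oo%E).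
  apply: (@le_trans _ _ +oo%E); first exact: leey.
  rewrite (bigD1 S)//= -/(CLS S) CS gt0_muley ?lte_fin//.
  by rewrite addye// -ltNye (lt_le_trans (ltNyr 0))// sume_ge0.
pose c S := fine (CLS S).
have c0 S : 0 <= c S by exact: fine_ge0.
have CLSE S : r S != 0 -> CLS S = (c S)%:E.
  move=> rS; rewrite /c fineK// ge0_fin_numE// lt_neqAle leey andbT.
  apply/eqP => CS; apply: nocase.
  by exists S; rewrite lt_neqAle eq_sym rS r_ge0.
rewrite (eq_bigr (fun S => (r S * c S)%:E)); last first.
  move=> S _; have [->|rS] := eqVneq (r S) 0; first by rewrite mul0e mul0r.
  by rewrite EFinM -CLSE.
rewrite sumEFin; apply: ereal_inf_lbound.
exists (\sum_(S : {set 'I_n}) r S * c S) => //=; split.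
  by rewrite sumr_ge0// => S _; rewrite mulr_ge0.
move=> f sf cf; have [M gM] := test_sq_within sf cf.
set I := \int[_]_x _.
rewrite -(entropy_drop_full mu (lexx 0) gM).
apply: (le_trans (entropy_drop_shearer mu gM r_ge0 r_cover)).
rewrite mulr_sumr mulr_suml ler_sum// => S _.
have [->|rS] := eqVneq (r S) 0; first by rewrite !mul0r mulr0 mul0r.
have -> : 2 * (r S * c S) * I = r S * (2 * c S * I) by ring.
rewrite ler_wpM2l//; apply: entropy_drop_log_sobolev => //.
exact/log_sobolev_constant_attained/CLSE.
Qed.
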